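(* If $p=2\pi+1$ where $\pi$ is a prime (and $p$ is prime), then $\mathscr{A}(p)=\mathscr{B}(p)$.
   Context: Let $p$ be a prime. For an integer $r\ge 2$ let $x_1,\ldots,x_r$ be independent indeterminates over $\mathbb{F}_p$ and $f(x)=(x-x_1)\cdots(x-x_r)\in\mathbb{F}_p[x_1,\ldots,x_r][x]$. For integers $e\ge 0$ and $0\le d\le p$ write $f(x)^e=\sum_{i\ge0}c_ix^i$ (with $c_i=0$ for $i<0$) and let $M_d(f(x)^e)$ be the $d\times d$ matrix whose $(i,j)$ entry is $c_{ip+j-d-1}$. Put $\delta(x_1,\ldots,x_r)=\prod_{1\le i<j\le r}(x_i-x_j)$. $\mathscr{A}(p)$ is the set of integer triples $(r,e,d)$ with $r\ge2$, $e\ge1$, $1\le d\le p$, such that $\det M_d(f(x)^e)=\varepsilon\,\delta(x_1,\ldots,x_r)^g$ for some $\varepsilon\in\mathbb{F}_p^{\times}$ and some positive integer $g$. $\mathscr{B}(p)=\mathscr{B}_+(p)\cup\mathscr{B}_0(p)\cup\mathscr{B}_-(p)$ where $\mathscr{B}_+(p)=\{(r,e,d): 2\le r\le p,\ e=p-1,\ d=r\}$, $\mathscr{B}_0(p)=\{(r,e,d): 2\le r\le p+1,\ (p-1)/2<e\le p-1,\ r(p-1-e)\le p-1,\ d=r-1\}$, $\mathscr{B}_-(p)=\{(r,e,d): r\ge2,\ (p-1)/2<e\le p-1,\ r(p-1-e)=p-1,\ d=r-2\}$ (integer triples). *)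

(* Defs.v *)
From HB Require Import structures.
From mathcomp Require Import all_boot all_order all_algebra.
From mathcomp Require Import mpoly.
Set Implicit Arguments. Unset Strict Implicit. Unset Printing Implicit Defensive.
Import GRing.Theory.
Local Open Scope ring_scope.

Definition fpoly (p r : nat) : {poly {mpoly 'F_p[r]}} :=
  \prod_(i < r) ('X - ('X_i)%:P).

Definition coefc (p r e : nat) (k : int) : {mpoly 'F_p[r]} :=
  match k with
  | Posz n => (fpoly p r ^+ e)`_n
  | Negz _ => 0
  end.

(* M_d(f^e): (i,j) entry (1-based i,j) is c_{ip+j-d-1};
   here i, j : 'I_d are 0-based, so the 1-based indices are i.+1, j.+1 *)
Definition Mmat (p r e d : nat) : 'M[{mpoly 'F_p[r]}]_d :=
  \matrix_(i < d, j < d)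
    coefc p r e ((i.+1 * p + j.+1)%:Z - (d.+1)%:Z).

Definition delta (p r : nat) : {mpoly 'F_p[r]} :=
  \prod_(i < r) \prod_(j < r | (i < j)%N) ('X_i - 'X_j).

Definition inA (p r e d : nat) : Prop :=
  [/\ (2 <= r)%N, (1 <= e)%N, (1 <= d <= p)%N &
    exists (eps : 'F_p) (g : nat),
      [/\ eps != 0, (0 < g)%N & \det (Mmat p r e d) = eps *: delta p r ^+ g]].

(* e and (p-1)/2: for the odd primes p of interest, (p-1)/2 is an integer;
   (p-1)/2 < e is stated as p - 1 < 2 e, which is exact over the rationals. *)
Definition inBplus (p r e d : nat) : Prop :=
  [/\ (2 <= r <= p)%N, e = p.-1 & d = r].
Definition inB0 (p r e d : nat) : Prop :=
  [/\ (2 <= r <= p.+1)%N, (p.-1 < 2 * e)%N, (e <= p.-1)%N,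
      (r * (p.-1 - e) <= p.-1)%N & d = r.-1].
Definition inBminus (p r e d : nat) : Prop :=
  [/\ (2 <= r)%N, (p.-1 < 2 * e)%N, (e <= p.-1)%N,
      (r * (p.-1 - e) = p.-1)%N & d = r.-2].
Definition inB (p r e d : nat) : Prop :=
  inBplus p r e d \/ inB0 p r e d \/ inBminus p r e d.

(* Main.v *)
Require Import Defs.
From mathcomp Require Import all_boot all_order all_algebra.
From mathcomp Require Import mpoly.
From mathcomp Require Import fingroup perm zify.

(* Reversing the columns turns M_d(f^e) into A with entries c_(ip-j), the matrix of the
   Cartier operator u |-> C(u f^e) truncated to degree < d. Put n = p-1, N = re.

   Substitute X_i := t^(w_i) with w strictly decreasing. For e < p the coefficient
   c_(N-m) gets t-degree exactly phi(m) = sum_(l < m) w_(l %/ e), the contribution of the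
   greedy monomial (its binomial coefficients are nonzero mod p). As phi is concave with
   linear pieces of length e <= n, the diagonal, whose indices ip-i are the least spread
   out, gives the unique dominant term of det A; so det A <> 0 as soon as
   dn <= N, and its degree is sum_i phi(N-in). If det A = eps delta^g this equals
   g sum_i (r-1-i) w_i for every w; comparing the coefficients of w in three directions
   gives three equations in g, r, e, d, whose only solutions are those of B(p).

   Conversely, when N <= (d+1)n, modulo (X_i - X_j)^(2e-p+1) the polynomial f^e is
   divisible by (x - X_i)^p, so that (1, X_i^p, X_i^(2p), ...) A = 0; hence
   (X_i - X_j)^(2e-p+1) divides det A. On B(p) the total degrees of det A and of
   delta^(2e-p+1) agree, and the quotient is a nonzero constant. *)

Section Development.
Set Implicit Arguments. Unset Strict Implicit. Unset Printing Implicit Defensive.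
Import GRing.Theory.
Local Open Scope ring_scope.

(** * Degrees of products and of determinants with a dominant diagonal *)

Lemma size_prod_succ (R : idomainType) (I : Type) (s : seq I) (P : pred I)
    (F : I -> {poly R}) (h : I -> nat) :
  (forall i, P i -> size (F i) = (h i).+1) ->
  size (\prod_(i <- s | P i) F i) = (\sum_(i <- s | P i) h i)%N.+1.
Proof.
move=> sF; elim/big_rec2: _ => [|i n Q Pi sQ]; first by rewrite size_poly1.
by rewrite size_mul -?size_poly_gt0 ?sF ?sQ // addSn addnS.
Qed.

Lemma size_prod_XsubC_exp_leq (R : idomainType) r (a : 'I_r -> R) e :
  (size ((\prod_(i < r) ('X - (a i)%:P)) ^+ e)%R <= (r * e).+1)%N.
Proof.
apply: (leq_trans (size_poly_exp_leq _ _)); rewrite ltnS leq_mul2r.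
rewrite (@size_prod_succ _ _ _ _ _ (fun=> 1%N)) => [|i _]; last exact: size_XsubC.
by rewrite sum1_card card_ord leqnn orbT.
Qed.

Lemma size_sum_max (R : nzRingType) (I : finType) (F : I -> {poly R}) i0 D :
  size (F i0) = D.+1 -> (forall i, i != i0 -> (size (F i) <= D)%N) ->
  size (\sum_i F i) = D.+1.
Proof.
move=> s0 sF; rewrite (bigD1 i0) //= size_polyDl s0 // ltnS.
by apply: (leq_trans (size_sum _ _ _)); apply/bigmax_leqP.
Qed.

(* The potentials [L] make the diagonal product the unique term of top degree: a
   nontrivial permutation raises some index. *)
Lemma size_det_dominant (R : idomainType) d (A : 'M[{poly R}]_d)
    (h : 'I_d -> nat) (L : nat -> nat) :
  (forall i, size (A i i) = (h i).+1) ->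
  (forall i j : 'I_d, A i j != 0%R -> size (A i j) + L i <= (h i).+1 + L j)%N ->
  (forall i j : 'I_d, (i < j)%N -> A i j != 0%R ->
     size (A i j) + L i <= h i + L j)%N ->
  size (\det A) = (\sum_i h i)%N.+1.
Proof.
move=> sA leA ltA; rewrite /determinant; apply: (@size_sum_max _ _ _ (1%g : 'S_d)).
  rewrite odd_perm1 expr0 mul1r -(big_mkcond xpredT) /=.
  by under eq_bigr do rewrite perm1; apply: size_prod_succ.
move=> s s1; rewrite mulr_sign; set P := \prod_i _.
suff : (size P <= \sum_i h i)%N by case: ifP => _ //; rewrite size_polyN.
have [->|P0] := eqVneq P 0; first by rewrite size_poly0.
have A0 i : A i (s i) != 0.
  by apply: contraNneq P0 => Ai; rewrite /P (bigD1 i) //= Ai mul0r.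
(* If [s i <= i] for all [i], then since [s] preserves the sum of the indices, every inequality is
   an equality and [s] is the identity. *)
have [k ltk] : exists k : 'I_d, (k < s k)%N.
  apply/existsP; apply: contraNT s1; rewrite negb_exists => /forallP le_s.
  have les i : (s i <= i)%N by rewrite leqNgt.
  apply/eqP/permP => i; rewrite perm1.
  have : (\sum_i s i == \sum_(i < d) i)%N.
    by rewrite [X in _ == X](reindex_inj (@perm_inj _ s)).
  have /leqif_sum := (fun (j : 'I_d) (_ : xpredT j) => leqif_eq (les j)).
  by move=> [_ ->] /forallP /(_ i) /eqP /val_inj.
have -> : size P = (\sum_i (size (A i (s i))).-1)%N.+1.
  by apply: size_prod_succ => i _; rewrite prednK // size_poly_gt0.
have : (\sum_i ((size (A i (s i))).-1 + L i) < \sum_i (h i + L (s i)))%N.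
  rewrite (bigD1 k) //= [X in (_ < X)%N](bigD1 k) //=.
  rewrite -addSn leq_add //.
    have := ltA _ _ ltk (A0 k); have := A0 k; rewrite -size_poly_gt0.
    by case: (size _).
  apply: leq_sum => i _.
  have := leA _ _ (A0 i); have := A0 i; rewrite -size_poly_gt0.
  by case: (size _).
rewrite !big_split /= -(reindex_inj (@perm_inj _ s) (P := xpredT) (F := fun i : 'I_d => L i)).
by rewrite ltn_add2r.
Qed.

(** * The Cartier matrix and the factor of its determinant coming from two roots *)

Definition cartier_mx (R : nzRingType) (p d : nat) (P : {poly R}) : 'M[R]_d :=
  \matrix_(i, j) P`_(i.+1 * p - j.+1).

Section Vanishing.

Variables (R : comNzRingType) (p : nat).
Hypothesis pR : p \in [pchar R].

(** Expand [('X - b%:P) ^+ e] in powers of [y], with ['X - b%:P = c + y]. The terms with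
    [p <= e + i] contain [y ^+ p] and form [U]; in the others [i < p - e], so the power
    [c ^+ (e - i)] has exponent at least [2 * e - p + 1]. *)
Lemma XsubC_exp_mod (a b : R) e : (p <= 2 * e)%N -> (e <= p)%N ->
  exists U V : {poly R}, (size U <= (2 * e - p).+1)%N /\
    ('X - a%:P) ^+ e * ('X - b%:P) ^+ e =
    ('X - a%:P) ^+ p * U + (a - b) ^+ (2 * e - p).+1 *: V.
Proof.
move=> p2e ep; set c := a - b; set y := 'X - a%:P.
exists (\sum_(i < e.+1 | (p <= e + i)%N) (c ^+ (e - i) *+ 'C(e, i)) *: y ^+ (e + i - p)).
exists (\sum_(i < e.+1 | ~~ (p <= e + i)%N)
          (c ^+ (e - i - (2 * e - p).+1) *+ 'C(e, i)) *: y ^+ (e + i)).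
split.
  apply: (leq_trans (size_sum _ _ _)); apply/bigmax_leqP => i pei.
  apply: (leq_trans (size_scale_leq _ _)); rewrite size_exp_XsubC.
  by have := ltn_ord i; lia.
have -> : 'X - b%:P = c%:P + y by rewrite /c /y polyCB [RHS]addrC addrA subrK.
rewrite [(c%:P + y) ^+ e]exprDn mulr_sumr (bigID (fun i : 'I_e.+1 => (p <= e + i)%N)) /=.
rewrite mulr_sumr scaler_sumr; congr (_ + _); apply: eq_bigr => i pei.
  rewrite -scalerAr -exprD subnKC // -scalerMnl mulrnAr -polyC_exp mulrCA.
  by rewrite mul_polyC -exprD.
have ie := ltn_ord i.
rewrite scalerA mulrnAr -exprD subnKC; last by lia.
by rewrite -scalerMnl mulrnAr -polyC_exp mulrCA mul_polyC -exprD.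
Qed.

(* For [G] of small degree the sum is the value at [a ^ p] of the Cartier image of
   a multiple of [(X - a) ^ p]. *)
Lemma sum_coef_XsubC_char (a : R) (G : {poly R}) d : (size G <= (d * p).-1)%N ->
  \sum_(i < d) a ^+ (p * i) * (('X - a%:P) ^+ p * G)`_(i.+1 * p).-1 = 0.
Proof.
have p0 : (0 < p)%N by rewrite prime_gt0 // (pcharf_prime pR).
(* The sum telescopes: its term of index [i] is [u i - u i.+1]. Index 0 is set apart because
   [(0 * p).-1] truncates to 0 and would pick up the constant coefficient of [G]. *)
pose u i := if i is i'.+1 then a ^+ (p * i) * G`_(i * p).-1 else 0.
move=> sG; transitivity (- u d); last first.
  by case: d sG => [|d] sG; rewrite /u ?oppr0 // nth_default ?mulr0 ?oppr0.
have -> : ('X - a%:P) ^+ p = 'X^p - (a ^+ p)%:P.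
  have pR' : p \in [pchar {poly R}] by rewrite (rmorph_pchar polyC).
  by have := pFrobenius_autB_comm pR' (mulrC 'X a%:P); rewrite !pFrobenius_autE polyC_exp.
elim: d {sG} => [|d IH]; first by rewrite big_ord0 /u oppr0.
rewrite big_ord_recr /= {}IH mulrBl coefB coefXnM coefCM /=.
rewrite mulrBr mulrA -exprD -mulnSr addrA; case: d => [|d].
  by rewrite mul1n prednK // leqnn mulr0 /u oppr0 !add0r.
rewrite ifF; last by rewrite mulSn; apply/negbTE; rewrite -leqNgt; lia.
have -> : ((d.+2 * p).-1 - p = (d.+1 * p).-1)%N by rewrite [(d.+2 * p)%N]mulSn; lia.
by rewrite addNr add0r.
Qed.

(** The row [v] of powers of [a ^+ p] is sent by the matrix to a multiple of [c]. Multiplying by the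
    adjugate and reading the first entry, where [v] is 1, puts the factor [c] in the determinant. *)
Lemma det_cartier_dvd (a b : R) (h : {poly R}) e d :
  (p <= 2 * e)%N -> (e <= p)%N -> (0 < d <= p)%N ->
  (size h + 2 * e <= (d.+1 * p.-1).+1)%N ->
  exists w, \det (cartier_mx p d (('X - a%:P) ^+ e * ('X - b%:P) ^+ e * h)) =
            (a - b) ^+ (2 * e - p).+1 * w.
Proof.
move=> p2e ep /andP[d0 dp] sh.
have p0 : (0 < p)%N by rewrite prime_gt0 // (pcharf_prime pR).
have [U [V [sU ->]]] := XsubC_exp_mod a b p2e ep.
set c : R := (a - b) ^+ _; set P := _ * h.
case: d d0 dp sh => // d _ dp sh.
pose v : 'rV_d.+1 := \row_i a ^+ (p * i).
pose z : 'rV_d.+1 := \row_j \sum_(i < d.+1) a ^+ (p * i) * ('X^j * (V * h))`_(i.+1 * p).-1.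
have vA : v *m cartier_mx p d.+1 P = c *: z.
  apply/rowP => j; rewrite !mxE.
  (* Multiplication by ['X^j] absorbs the column index, so all coefficients are read at the indices
     of [sum_coef_XsubC_char]. *)
  transitivity (\sum_(i < d.+1) a ^+ (p * i) * ('X^j * P)`_(i.+1 * p).-1).
    apply: eq_bigr => i _; rewrite !mxE; congr (_ * _).
    have jd := ltn_ord j; rewrite coefXnM ifF; last first.
      by apply/negbTE; rewrite -leqNgt mulSn; lia.
    by congr (_`_ _); lia.
  have EP : 'X^j * P = ('X - a%:P) ^+ p * ('X^j * (U * h)) + c *: ('X^j * (V * h)).
    rewrite /P mulrDl mulrDr -!scalerAl -scalerAr; congr (_ + _).
    by rewrite -mulrA mulrCA.
  rewrite EP.
  under eq_bigr do rewrite coefD mulrDr coefZ [X in _ + X]mulrCA.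
  rewrite big_split /= sum_coef_XsubC_char ?add0r ?mulr_sumr //.
  have jd := ltn_ord j.
  apply: (leq_trans (size_polyMleq _ _)); rewrite size_polyXn.
  have := size_polyMleq U h; move: sh; rewrite !mulSn; nia.
have /rowP/(_ ord0) : v *m cartier_mx p d.+1 P *m \adj (cartier_mx p d.+1 P) =
    (\det (cartier_mx p d.+1 P)) *: v.
  by rewrite -mulmxA mul_mx_adj mul_mx_scalar.
rewrite vA -scalemxAl !mxE muln0 expr0 mulr1 => <-.
by eexists.
Qed.

End Vanishing.

(** * Divisibility by powers of the differences of variables *)

Lemma prod_exp_dvd (K : idomainType) (I : eqType) (s : seq I) (D : I -> K) (P : K) g :
  uniq s -> {in s, forall k, D k != 0} ->
  {in s &, forall k l, k != l ->
     forall B, (exists c, D l * B = D k * c) -> exists c, B = D k * c} ->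
  {in s, forall k, exists c, P = D k ^+ g * c} ->
  exists c, P = (\prod_(k <- s) D k ^+ g) * c.
Proof.
elim: s => [|k s IH] /=; first by exists P; rewrite big_nil mul1r.
move=> /andP[ks us] D0 cop dvdP.
have k_in : k \in k :: s by rewrite mem_head.
have s_in l : l \in s -> l \in k :: s by rewrite inE orbC => ->.
have [c Ec] : exists c, P = (\prod_(l <- s) D l ^+ g) * c.
  by apply: IH => // [l /s_in /D0|l m /s_in ls /s_in ms|l /s_in]; [|exact: cop|exact: dvdP].
have copX l m B : l \in s -> (exists c, D l ^+ m * B = D k * c) -> exists c, B = D k * c.
  move=> ls; elim: m => [|m IHm]; first by rewrite mul1r.
  rewrite exprS -mulrA => H; apply: IHm; apply: cop H => //; first exact: s_in.
  by apply: contraNneq ks => ->.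
have coprod B : (exists c, (\prod_(l <- s) D l ^+ g) * B = D k * c) ->
    exists c, B = D k * c.
  rewrite big_seq; elim/big_rec: _ B => [|l Q ls IHQ] B; first by rewrite mul1r.
  by rewrite -mulrA => /(copX _ _ _ ls) /IHQ.
have [c1] := dvdP k k_in; rewrite {1}Ec => E1.
suff dvdc n : (n <= g)%N -> exists c', c = D k ^+ n * c'.
  by have [c' Ec'] := dvdc g (leqnn g); exists c'; rewrite big_cons Ec Ec' mulrCA mulrA.
elim: n => [|n IHn] ng; first by exists c; rewrite mul1r.
have [c' Ec'] := IHn (ltnW ng).
have [|c'' Ec''] := coprod c'; last by exists c''; rewrite exprSr -mulrA -Ec''.
exists (D k ^+ (g - n.+1) * c1).
apply: (mulfI (expf_neq0 n (D0 k k_in))).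
by rewrite mulrCA -Ec' E1 !mulrA -exprSr -exprD subnKC.
Qed.

Section VariableDifferences.

Variables (n : nat) (R : idomainType).

Lemma mpolyXU_sub_neq0 (i j : 'I_n) : i != j -> 'X_i - 'X_j != 0 :> {mpoly R[n]}.
Proof.
move=> ij; rewrite subr_eq0; apply/negP => /eqP /(congr1 (fun P => P@_U_(i))).
by rewrite !mcoeffXU eqxx eq_sym (negbTE ij) => /eqP; rewrite oner_eq0.
Qed.

Let identify (i j k : 'I_n) : {mpoly R[n]} := if k == i then 'X_j else 'X_k.
Local Notation sigma i j := (mmap (@mpolyC n R) (identify i j)).

(** A factor theorem for the substitution [X_i := X_j]: the property passes to sums and products, so
    constants and variables suffice. *)
Lemma sub_identify_dvd (i j : 'I_n) (P : {mpoly R[n]}) :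
  exists c, P - sigma i j P = ('X_i - 'X_j) * c.
Proof.
pose ok P := exists c, P - sigma i j P = ('X_i - 'X_j) * c.
have okD A B : ok A -> ok B -> ok (A + B).
  move=> [a Ea] [b Eb]; exists (a + b).
  by rewrite rmorphD opprD addrACA Ea Eb mulrDr.
have okM A B : ok A -> ok B -> ok (A * B).
  move=> [a Ea] [b Eb]; exists (a * B + sigma i j A * b).
  by rewrite mulrDr mulrA -Ea mulrCA -Eb rmorphM mulrBl mulrBr addrA subrK.
have okC c : ok c%:MP by exists 0; rewrite mmapC subrr mulr0.
rewrite -/(ok P) [P]mpolyE; apply: big_ind => [||m _]; [exact: (okC 0)|exact: (okD)|].
rewrite -mul_mpolyC; apply: (okM) => //; rewrite mpolyXE_id.
apply: big_ind => [||k _]; [exact: (okC 1)|exact: (okM)|].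
elim: (m k) => [|d IH]; first exact: (okC 1).
rewrite exprS; apply: (okM) => //; rewrite /ok mmapX mmap1U /identify.
by case: eqP => [->|_]; [exists 1; rewrite mulr1 | exists 0; rewrite subrr mulr0].
Qed.

(** Identifying the two variables of [k] kills the right side but not the difference attached to
    [l], as the ordered pairs differ; hence it kills [B]. *)
Lemma mpolyXU_sub_coprime (k l : 'I_n * 'I_n) : (k.1 < k.2)%N -> (l.1 < l.2)%N ->
  k != l -> forall B : {mpoly R[n]},
  (exists c, ('X_l.1 - 'X_l.2) * B = ('X_k.1 - 'X_k.2) * c) ->
  exists c, B = ('X_k.1 - 'X_k.2) * c.
Proof.
case: k l => [i j] [k l] /= ij kl ne B [c E].
have [b Eb] := sub_identify_dvd i j B.
suff B0 : sigma i j B = 0 by exists b; rewrite -Eb B0 subr0.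
have /eqP := congr1 (sigma i j) E; rewrite !rmorphM !rmorphB /= !mmapX !mmap1U.
rewrite /identify eqxx (_ : (j == i) = false); last by rewrite -val_eqE /= gtn_eqF.
rewrite subrr mul0r mulf_eq0 => /orP[|/eqP //].
apply: contraTeq => _; case: (eqVneq k i) => [ki|ki]; case: (eqVneq l i) => [li|li].
- by move: kl; rewrite ki li ltnn.
- by apply: mpolyXU_sub_neq0; apply: contraNneq ne => jl; rewrite ki jl.
- by apply: mpolyXU_sub_neq0; apply: contraTneq kl => kj; rewrite kj li -leqNgt ltnW.
- by apply: mpolyXU_sub_neq0; rewrite -val_eqE /= ltn_eqF.
Qed.

(** * Total degrees in the variables *)

Lemma leq_msize_prod (I : Type) (s : seq I) (P : pred I) (F : I -> {mpoly R[n]})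
    (h : I -> nat) :
  (forall i, P i -> (h i < msize (F i))%N) ->
  (\sum_(i <- s | P i) h i < msize (\prod_(i <- s | P i) F i))%N.
Proof.
move=> hF; elim/big_rec2: _ => [|i m Q Pi mQ]; first by rewrite msize1.
have F0 := hF i Pi; rewrite msizeM -?msize_poly_eq0 -?lt0n ?(leq_trans _ F0) ?(leq_trans _ mQ) //.
by lia.
Qed.

Lemma msize_prod_leq (I : Type) (s : seq I) (F : I -> {mpoly R[n]}) :
  \prod_(i <- s) F i != 0 ->
  (msize (\prod_(i <- s) F i) <= (\sum_(i <- s) (msize (F i)).-1).+1)%N.
Proof.
elim: s => [|i s IH]; first by rewrite !big_nil msize1.
rewrite !big_cons mulf_eq0 negb_or => /andP[F0 Q0].
have := IH Q0; rewrite msizeM //; lia.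
Qed.

Lemma msize_mpolyXU_sub (i j : 'I_n) : i != j -> (1 < msize ('X_i - 'X_j : {mpoly R[n]}))%N.
Proof.
move=> ij; rewrite -(mdeg1 i); apply: msize_mdeg_lt.
rewrite mcoeff_msupp mcoeffB !mcoeffXU eqxx [j == i]eq_sym (negbTE ij) subr0.
exact: oner_neq0.
Qed.

(** Total degree at most [N] with ['X] counted as degree 1. Since [msize] is the degree plus one,
    the truncated bound also makes the coefficients beyond [N] vanish. *)
Definition weighted_degree_le (P : {poly {mpoly R[n]}}) (N : nat) :=
  forall k, (msize (P`_k) <= N.+1 - k)%N.

Lemma weighted_degree_leM P Q N M :
  weighted_degree_le P N -> weighted_degree_le Q M -> weighted_degree_le (P * Q) (N + M).
Proof.
move=> hP hQ k; rewrite coefM; apply: (leq_trans (msize_sum _ _ _)).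
apply/bigmax_leqP => i _.
have [->|P0] := eqVneq P`_i 0; first by rewrite mul0r msize0.
have [->|Q0] := eqVneq Q`_(k - i) 0; first by rewrite mulr0 msize0.
have := hP i; have := hQ (k - i)%N; have ik := ltn_ord i.
rewrite msizeM //; move: P0 Q0; rewrite -!msize_poly_eq0; lia.
Qed.

Lemma weighted_degree_le1 : weighted_degree_le 1 0.
Proof. by move=> k; rewrite coef1; case: k => [|k]; rewrite ?msize1 ?msize0. Qed.

Lemma weighted_degree_le_XsubXU (i : 'I_n) : weighted_degree_le ('X - ('X_i)%:P) 1.
Proof.
move=> k; rewrite coefB coefX coefC; case: k => [|[|k]] /=.
- by rewrite sub0r msizeN msizeX mdeg1.
- by rewrite subr0 msize1.
- by rewrite subr0 msize0.
Qed.

Lemma weighted_degree_le_fpoly_exp e :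
  weighted_degree_le ((\prod_(i < n) ('X - ('X_i)%:P)) ^+ e) (n * e).
Proof.
have wf : weighted_degree_le (\prod_(i < n) ('X - ('X_i)%:P)) n.
  rewrite -[X in weighted_degree_le _ X]card_ord -sum1_card.
  elim/big_rec2: _ => [|i Q N _ hQ]; first exact: weighted_degree_le1.
  by rewrite add1n -addn1 addnC; apply: weighted_degree_leM (weighted_degree_le_XsubXU i) hQ.
elim: e => [|e IH]; first by rewrite muln0; exact: weighted_degree_le1.
by rewrite exprS mulnS; apply: weighted_degree_leM.
Qed.

Lemma msize_det_cartier_leq p d P N : (0 < p)%N -> (d <= p)%N -> (d * p.-1 <= N)%N ->
  weighted_degree_le P N ->
  (msize (\det (cartier_mx p d P)) <= (\sum_(i < d) (N - i.+1 * p.-1)).+1)%N.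
Proof.
move=> p0 dp dN hP; apply: (leq_trans (msize_sum _ _ _)); apply/bigmax_leqP => s _.
rewrite mulr_sign; set Q := \prod_i _.
suff : (msize Q <= (\sum_(i < d) (N - i.+1 * p.-1)).+1)%N by case: ifP; rewrite ?msizeN.
have [->|Q0] := eqVneq Q 0; first by rewrite msize0.
apply: (leq_trans (msize_prod_leq Q0)); rewrite ltnS.
(* Adding the sum of the indices, reindexed by [s] on one side, cancels the dependence of the
   degrees on [s] and leaves a termwise comparison. *)
rewrite -(leq_add2r (\sum_(i < d) i)) -big_split /=.
rewrite [X in (_ <= _ + X)%N](reindex_inj (@perm_inj _ s)) -big_split /=.
apply: leq_sum => i _; rewrite mxE.
have P0 : P`_(i.+1 * p - (s i).+1) != 0.
  by apply: contraNneq Q0 => Pi; rewrite /Q (bigD1 i) //= mxE Pi mul0r.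
have := hP (i.+1 * p - (s i).+1)%N; move: P0; rewrite -msize_poly_eq0.
have id := ltn_ord i; have sd := ltn_ord (s i).
have : (p.-1 <= i.+1 * p.-1)%N by rewrite leq_pmull.
have : (i.+1 * p.-1 <= N)%N by apply: leq_trans dN; rewrite leq_mul2r id orbT.
have -> : (i.+1 * p = i.+1 * p.-1 + i.+1)%N by rewrite -[in LHS](prednK p0) mulnS addnC.
by set m := msize _; set a := (_ * _)%N; lia.
Qed.

End VariableDifferences.

(** * Greedy weights *)

Section Weights.

Variables (e : nat) (w : nat -> nat).

(** This is [phi]: for decreasing [w], the largest weight of [m] indices each used at most [e]
    times. *)
Definition top_weight (m : nat) := (\sum_(l < m) w (l %/ e))%N.

Lemma top_weightD a k :
  (top_weight (a + k) = top_weight a + \sum_(l < k) w ((a + l) %/ e))%N.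
Proof. by rewrite /top_weight big_split_ord. Qed.

Hypothesis e_gt0 : (0 < e)%N.

Lemma top_weight_excess r m : (m <= r.+1 * e)%N ->
  (top_weight m = top_weight (m - (m - r * e)) + (m - r * e) * w r)%N.
Proof.
move=> mre; have [le_m|lt_m] := leqP m (r * e).
  by rewrite (eqP le_m) subn0 mul0n addn0.
rewrite subKn 1?ltnW // -[in LHS](subnKC (ltnW lt_m)) top_weightD; congr addn.
rewrite -[X in (_ = X * _)%N]card_ord -sum_nat_const; apply: eq_bigr => l _.
rewrite divnMDl // divn_small ?addn0 //.
by have := ltn_ord l; rewrite mulSn in mre; lia.
Qed.

(** At least [m - r * e] copies of the lightest weight [w r] are forced; each further copy displaces
    a strictly heavier weight. *)
Lemma top_weight_drop r m b : (forall i, i < r -> w r < w i)%N ->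
  (m - r * e < b <= m)%N -> (m <= r.+1 * e)%N ->
  (top_weight (m - b) + b * w r < top_weight m)%N.
Proof.
move=> ltw /andP[b0b bm] mre; set b0 := (m - r * e)%N in b0b.
rewrite (top_weight_excess mre) -/b0.
have -> : (m - b0 = (m - b) + (b - b0))%N by lia.
rewrite top_weightD -addnA ltn_add2l.
have -> : (b * w r = (b - b0) * w r + b0 * w r)%N by rewrite -mulnDl subnK // ltnW.
rewrite ltn_add2r -[X in (X * _ < _)%N]card_ord -sum_nat_const.
have ltl (l : 'I_(b - b0)) : (w r < w ((m - b + l) %/ e))%N.
  by apply: ltw; rewrite ltn_divLR //; have := ltn_ord l; lia.
have b'0 : (0 < b - b0)%N by rewrite subn_gt0.
rewrite (bigD1 (Ordinal b'0)) //= [X in (_ < X)%N](bigD1 (Ordinal b'0)) //=.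
by rewrite -addSn leq_add //; [exact: ltl (Ordinal b'0) | apply: leq_sum => l _; exact: ltnW].
Qed.

End Weights.

(** * Degrees of the coefficients and of the determinant after specialization *)

Section CoefDegree.

Variables (F : fieldType) (p e : nat).
Hypotheses (pF : p \in [pchar F]) (e_gt0 : (0 < e)%N) (e_lt_p : (e < p)%N).

Lemma natr_bin_neq0 i : (i <= e)%N -> ('C(e, i)%:R : F) != 0.
Proof.
have pp := pcharf_prime pF.
move=> ie; rewrite -(dvdn_pcharf pF); apply/negP => pd.
have : (p %| e`!)%N by rewrite -(bin_fact ie) dvdn_mulr.
apply/negP; elim: e e_lt_p => [|k IH] kp; first by rewrite dvdn1; case: eqP pp => // ->.
by rewrite factS Euclid_dvdM // negb_or IH ?(ltnW kp) // andbT gtnNdvd.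
Qed.

(** Induction on the number of roots: expand the factor of the lightest root binomially. By
    [top_weight_drop] the term with [b = m - r * e] alone has the top degree, and its binomial
    coefficient is nonzero because [e < p]. *)
Lemma size_coef_prod_XsubXn (w : nat -> nat) r m :
  (forall i j, i < j < r -> w j < w i)%N -> (m <= r * e)%N ->
  size (((\prod_(i < r) ('X - ('X^(w i))%:P) : {poly {poly F}}) ^+ e)`_(r * e - m))
  = (top_weight e w m).+1.
Proof.
elim: r m => [|r IH] m ltw mre.
  have -> : m = 0%N by lia.
  by rewrite big_ord0 expr1n coef1 size_poly1 /top_weight big_ord0.
rewrite big_ord_recr /= exprMn.
set P := (\prod_(i < r) _) ^+ e in IH *.
have sP : (size P <= (r * e).+1)%N by apply: size_prod_XsubC_exp_leq.
have IH' m' := IH m' (fun i j H => ltw i j ltac:(lia)).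
have -> : P * ('X - ('X^(w r))%:P) ^+ e =
   \sum_(b < e.+1) (P * 'X^(e - b)) *
      (((-1) ^+ b *+ 'C(e, b)) *: ('X^(w r * b) : {poly F}))%:P.
  rewrite exprBn mulr_sumr; apply: eq_bigr => b _.
  rewrite exprM -scalerMnl -mul_polyC polyCMn polyCM !polyC_exp !polyCN !mulrnAr.
  by rewrite !polyC1 -!mulrA; congr (P * _ *+ _); rewrite mulrCA.
rewrite coef_sum.
have b0e : (m - r * e < e.+1)%N by rewrite mulSn in mre; lia.
set T := fun b : 'I_(e.+1) =>
  (P * 'X^(e - b) *
     (((-1) ^+ b *+ 'C(e, b)) *: ('X^(w r * b) : {poly F}))%:P)`_(r.+1 * e - m).
(* For smaller [b] the coefficient of [P] would have a negative index, for larger [b] an index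
   beyond its degree [r * e]. *)
have T0 (b : 'I_e.+1) : ~~ (m - r * e <= b <= m)%N -> T b = 0.
  move=> Hb; rewrite /T coefMC coefMXn; case: ifP => [_|ge]; first by rewrite mul0r.
  rewrite nth_default ?mul0r //; apply: (leq_trans sP).
  by have := ltn_ord b; rewrite mulSn in mre ge Hb *; lia.
have sT (b : 'I_e.+1) : (m - r * e <= b <= m)%N ->
    size (T b) = (top_weight e w (m - b) + b * w r).+1.
  move=> Hb; rewrite /T coefMC coefMXn ltnNge.
  have be := ltn_ord b.
  rewrite (_ : (e - b <= _)%N); last by rewrite mulSn in mre *; lia.
  rewrite (_ : (r.+1 * e - m - (e - b) = r * e - (m - b))%N); last first.
    by rewrite mulSn in mre *; lia.
  have sPm := IH' (m - b)%N ltac:(lia).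
  rewrite -scalerAr size_scale; last first.
    by rewrite -mulr_natr mulf_neq0 ?signr_eq0 // natr_bin_neq0 // -ltnS.
  by rewrite size_mulXn -?size_poly_gt0 ?sPm // addnS addnC mulnC.
apply: (@size_sum_max _ _ _ (Ordinal b0e)) => [|b].
  rewrite (sT (Ordinal b0e)) /=; last by rewrite mulSn in mre *; lia.
  by rewrite -top_weight_excess.
rewrite -val_eqE /= => nb.
have [Hb|Hb] := boolP (m - r * e <= b <= m)%N; last by rewrite -/(T b) T0 // size_poly0.
rewrite -/(T b) sT //; apply: top_weight_drop => // [i ir|].
  by apply: ltw; rewrite ir ltnSn.
by rewrite ltn_neqAle eq_sym nb.
Qed.

Lemma size_det_cartier_prod_XsubXn (w : nat -> nat) r d :
  (forall i j, i < j < r -> w j < w i)%N -> (forall i j, i <= j -> w j <= w i)%N ->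
  (d <= p)%N -> (d * p.-1 <= r * e)%N ->
  size (\det (cartier_mx p d
    ((\prod_(i < r) ('X - ('X^(w i))%:P) : {poly {poly F}}) ^+ e)))
  = (\sum_(i < d) top_weight e w (r * e - i.+1 * p.-1))%N.+1.
Proof.
move=> ltw lew dp dN; set N := (r * e)%N in dN *; set P := _ ^+ e.
have p0 : (0 < p)%N by apply: leq_trans e_lt_p.
have en : (e <= p.-1)%N by rewrite -ltnS prednK.
have Ep i : (i * p = i * p.-1 + i)%N by rewrite -[in LHS](prednK p0) mulnS addnC.
have rowN i : (i < d)%N -> (i.+1 * p.-1 <= N)%N.
  by move=> id; apply: leq_trans dN; rewrite leq_mul2r id orbT.
have sizeP k : (k <= N)%N -> size P`_k = (top_weight e w (N - k)).+1.
  by move=> kN; rewrite -{1}(subKn kN) size_coef_prod_XsubXn // leq_subr.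
have P0 k : P`_k != 0 -> (k <= N)%N.
  apply: contraR; rewrite -ltnNge => Nk; rewrite nth_default //.
  exact: leq_trans (size_prod_XsubC_exp_leq _ _) Nk.
(* The summand is the slope of [top_weight e w] just right of [N - l.+2 * p.-1]. *)
pose L j := (\sum_(l < j) w ((N - l.+2 * p.-1) %/ e))%N.
have LD i k : (L (i + k) = L i + \sum_(l < k) w ((N - (i + l).+2 * p.-1) %/ e))%N.
  by rewrite /L big_split_ord.
have up (i j : 'I_d) : (i < j)%N -> P`_(i.+1 * p - j.+1) != 0 ->
    (size (P`_(i.+1 * p - j.+1))%R + L i <= top_weight e w (N - i.+1 * p.-1) + L j)%N.
  move=> ij /P0 kN; rewrite sizeP //.
  have jd := ltn_ord j; have id := ltn_ord i; have := rowN _ id => aN.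
  have := rowN _ (leq_ltn_trans ij jd) => bN; rewrite mulSn in bN.
  have -> : (N - (i.+1 * p - j.+1) = (N - i.+1 * p.-1) + (j - i))%N.
    by rewrite Ep; move: kN; rewrite Ep; lia.
  have -> : L j = L (i + (j - i))%N by rewrite subnKC // ltnW.
  rewrite top_weightD LD; set S1 := \sum_(l < _) _; set S2 := \sum_(l < _) _.
  suff : (S1 < S2)%N by lia.
  (* The two arguments differ by [l.+1 * p.-1 + l], at least [e], so their quotients by [e] differ
     and [w] separates them strictly. *)
  have step l : (l < j - i)%N ->
      (w ((N - i.+1 * p.-1 + l) %/ e) < w ((N - (i + l).+2 * p.-1) %/ e))%N.
    move=> lt_l; have := rowN (i + l).+1 ltac:(lia) => cN.
    apply: ltw; apply/andP; split; last first.
      by rewrite ltn_divLR // -/N; rewrite mulSn in aN *; lia.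
    have divn1_e : (e %/ e = 1)%N by rewrite divnn e_gt0.
    rewrite -addn1 -[X in (_ + X <= _)%N]divn1_e -divnDr //.
    by apply: leq_div2r; rewrite !mulSn ?mulnDl in cN *; lia.
  have k0 : (0 < j - i)%N by rewrite subn_gt0.
  rewrite /S1 /S2 (bigD1 (Ordinal k0)) //= [X in (_ < X)%N](bigD1 (Ordinal k0)) //=.
  rewrite -[X in (X <= _)%N]addSn leq_add ?step //.
  by apply: leq_sum => l _; rewrite ltnW ?step.
have down (i j : 'I_d) : (j < i)%N -> P`_(i.+1 * p - j.+1) != 0 ->
    (size (P`_(i.+1 * p - j.+1))%R + L i <= (top_weight e w (N - i.+1 * p.-1)).+1 + L j)%N.
  move=> ji /P0 kN; rewrite sizeP //.
  have jd := ltn_ord j; have id := ltn_ord i; have := rowN _ id => aN.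
  have -> : (N - i.+1 * p.-1 = (N - (i.+1 * p - j.+1)) + (i - j))%N.
    by move: kN; rewrite Ep; lia.
  have -> : L i = L (j + (i - j))%N by rewrite subnKC // ltnW.
  rewrite top_weightD LD; set S1 := \sum_(l < _) _; set S2 := \sum_(l < _) _.
  suff : (S1 <= S2)%N by lia.
  apply: leq_sum => l _; apply: lew; apply: leq_div2r.
  have lt_l := ltn_ord l.
  have : ((j + l).+2 * p.-1 <= i.+1 * p.-1)%N by rewrite leq_mul2r; apply/orP; right; lia.
  by move: kN; rewrite Ep; lia.
apply: (@size_det_dominant _ _ _ _ L) => [i|i j|i j ij]; rewrite mxE.
- by rewrite Ep addnK sizeP ?rowN.
- case: (ltngtP i j) => [ij Pij|ji|/val_inj -> _].
  + by rewrite (leq_trans (up _ _ ij Pij)) // addSn leqnSn.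
  + exact: down.
  + by rewrite Ep addnK sizeP ?rowN.
- exact: up.
Qed.

End CoefDegree.

(** * Solving the weight equations; finite sums *)

Section Arithmetic.

Local Open Scope nat_scope.

(* Here the parameters of the matrix are [r.+1] and [d.+1], [e + s] is [p - 1] and [b]
   is the excess [re - d(p-1)]. *)
Lemma weight_equations_solve r e d s b g :
  1 <= r -> 0 < e -> 0 < g ->
  r.+1 * e = d.+1 * (e + s) + b ->
  g * r = minn b e + d * e ->
  g * (2 * r).-1 = minn b (2 * e) +
    (if d is d'.+1 then minn (b + (e + s)) (2 * e) + d' * (2 * e) else 0) ->
  g * (r.+1 * r) = d.+1 * (2 * b + (e + s) * d) ->
  [\/ s = 0 /\ d = r, [/\ d.+1 = r, s < e & r.+1 * s <= e + s]
    | [/\ d.+2 = r, s < e & r.+1 * s = e + s]].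
Proof.
move=> r1 e0 g0 EN E1 E2 E3.
have E13 : r.+1 * (minn b e + d * e) = d.+1 * (2 * b + (e + s) * d).
  by rewrite -E1 -E3 mulnCA.
have G2 : g * (2 * r).-1 + g = 2 * (g * r).
  by rewrite -mulnSr prednK ?muln_gt0 // mulnCA.
(* The case [e <= b] leads to the second and third alternatives, [0 < b < e] to the second, [b = 0]
   to the first and second. *)
have [le_eb|lt_be] := leqP e b.
  have Eb : b = e + s.
    have : d.+1 * (d.+1 * (e + s) + b) = d.+1 * (2 * b + (e + s) * d).
      by rewrite -E13 -EN (minn_idPr le_eb) -mulSn mulnCA.
    by move/eqP; rewrite eqn_pmul2l // => /eqP; lia.
  have E1' : g * r = d.+1 * e by rewrite E1 (minn_idPr le_eb).
  have E2' : g * (2 * r).-1 = minn (e + s) (2 * e) + d * (2 * e).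
    by rewrite E2 Eb; case: (d) => [|d'] //; rewrite mulSn; congr addn; congr addn; lia.
  (* Twice [E1] minus [E2] isolates [g]; as [g] is positive, the minimum must be [e + s], whence
     [s < e] and [g = e - s]. *)
  have Eg : g + minn (e + s) (2 * e) = 2 * e by lia.
  have lt_se : s < e by lia.
  have Eg' : g + s = e by lia.
  have Er : g * r + s * r = e * r by rewrite -mulnDl Eg'.
  have [s0|s0] := posnP s.
    constructor 2; split; rewrite ?s0 ?muln0 //.
    apply/eqP; rewrite -(eqn_pmul2l e0); apply/eqP.
    by rewrite -Er E1' s0 addn0 mulnC.
  (* s r = (c - 1) e and s (r + 1) = (c - 1) (e + s), where c = r - d *)
  have Ed : s * d.+2 = s * r by lia.
  have dr : d.+2 = r by move/eqP: Ed; rewrite eqn_pmul2l // => /eqP.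
  by constructor 3; split=> //; subst r b; lia.
have [b0|b0] := posnP b; last first.
  have EdN : d * (r.+1 * e) = d * (d.+1 * (e + s) + b) by rewrite EN.
  have Ed : b * (r + d.+1) = b * (d.+1 + d.+1).
    by move: E13; rewrite (minn_idPl (ltnW lt_be)); lia.
  have dr : d.+1 = r by move/eqP: Ed; rewrite eqn_pmul2l // => /eqP; lia.
  have Ee : e = d.+1 * s + b by subst r; lia.
  have le_s : s <= d.+1 * s by rewrite leq_pmull.
  by constructor 2; split=> //; subst r; lia.
subst b; rewrite min0n ?add0n in E1 E2 E13.
case: d E1 E2 E3 E13 EN => [|d] E1 E2 E3 E13 EN.
  by have : 0 < g * r; [rewrite muln_gt0 g0 | rewrite E1].
rewrite min0n add0n in E2.
have Eg : g + minn (e + s) (2 * e) = 2 * e by lia.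
have lt_se : s < e by lia.
have Eg' : g + s = e by lia.
have Er : g * r + s * r = e * r by rewrite -mulnDl Eg'.
have [s0|s0] := posnP s.
  constructor 1; split=> //; apply/eqP; rewrite -(eqn_pmul2l e0); apply/eqP.
  by rewrite -Er E1 s0 addn0 mulnC.
have Ed : s * d.+2 = s * r by lia.
have dr : d.+2 = r by move/eqP: Ed; rewrite eqn_pmul2l // => /eqP.
by constructor 2; split=> //; subst r; lia.
Qed.

Lemma sum_sub_arith (N n d : nat) (F : nat -> nat) : d * n <= N ->
  \sum_(i < d) F (N - i.+1 * n) = \sum_(k < d) F (N - d * n + k * n).
Proof.
move=> dN; rewrite (reindex_inj rev_ord_inj); apply: eq_bigr => k _ /=.
have kd := ltn_ord k.
rewrite subnSK // mulnBl; have le_k : k * n <= d * n by rewrite leq_mul2r (ltnW kd) orbT.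
by congr F; lia.
Qed.

Lemma sum_lt_minn m t : \sum_(l < m) (l < t) = minn m t.
Proof. by elim: m => [|m IH]; rewrite ?big_ord0 ?min0n // big_ord_recr /= IH; lia. Qed.

Lemma sum_pred_sub r : 2 * \sum_(i < r) (r.-1 - i) = r * r.-1.
Proof.
elim: r => [|r IH]; first by rewrite big_ord0.
rewrite big_ord_recl /= subn0 mulnDr.
have -> : \sum_(i < r) (r - bump 0 i) = \sum_(i < r) (r.-1 - i).
  by apply: eq_bigr => i _; rewrite /bump; lia.
by rewrite IH; case: r {IH} => //= r; lia.
Qed.

Lemma sum_gt_ord r (i : 'I_r) c :
  \sum_(j < r | i < j) c = (r.-1 - i) * c.
Proof.
have := @big_geq_mkord _ 0 addn i.+1 r xpredT (fun=> c).
by rewrite sum_nat_const_nat => <-; rewrite -subn1 -subnDA add1n.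
Qed.

Lemma sum_arith b n d : 2 * \sum_(k < d.+1) (b + k * n) = d.+1 * (2 * b + n * d).
Proof.
elim: d => [|d IH]; first by rewrite big_ord1 /= mul0n; lia.
by rewrite big_ord_recr /= mulnDr IH; lia.
Qed.

(** Only the first term of the progression can lie below [c]. *)
Lemma sum_min_arith b n c d : c <= b + n ->
  \sum_(k < d.+1) minn (b + k * n) c = minn b c + d * c.
Proof.
move=> cn; rewrite big_ord_recl mul0n addn0; congr addn.
rewrite -[d in RHS]card_ord -sum_nat_const; apply: eq_bigr => k _.
by rewrite lift0 mulSn; lia.
Qed.

End Arithmetic.

(** * The matrix over the prime field and its specializations *)

Section PrimeField.

Variable p : nat.
Hypothesis p_prime : prime p.

Lemma det_Mmat r e d : (d <= p)%N ->
  exists s : bool,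
    \det (Mmat p r e d) = (-1) ^+ s * \det (cartier_mx p d (fpoly p r ^+ e)).
Proof.
move=> dp; pose s := perm (@rev_ord_inj d); exists (odd_perm s).
have -> : Mmat p r e d = col_perm s (cartier_mx p d (fpoly p r ^+ e)).
  apply/matrixP => i j; rewrite !mxE permE /=.
  have jd := ltn_ord j.
  have le_k : (d - j <= i.+1 * p)%N by rewrite mulSn; lia.
  (* As [d <= p], the integer index is never negative and [coefc] reads a genuine coefficient. *)
  have -> : ((i.+1 * p + j.+1)%:Z - d.+1%:Z = (i.+1 * p - (d - j.+1).+1)%:Z)%R by lia.
  by [].
by rewrite col_permE det_mulmx det_perm odd_permV mulrC.
Qed.

Section Specialization.

Variables (r : nat) (S : comNzRingType) (f : {rmorphism 'F_p -> S}) (h : 'I_r -> S).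

Lemma mmap_delta :
  mmap f h (delta p r) = \prod_(i < r) \prod_(j < r | (i < j)%N) (h i - h j).
Proof.
rewrite rmorph_prod; apply: eq_bigr => i _; rewrite rmorph_prod.
by apply: eq_bigr => j _; rewrite rmorphB /= !mmapX !mmap1U.
Qed.

Lemma mmap_det_cartier e d :
  mmap f h (\det (cartier_mx p d (fpoly p r ^+ e))) =
  \det (cartier_mx p d ((\prod_(i < r) ('X - (h i)%:P)) ^+ e)).
Proof.
rewrite -det_map_mx; congr (\det _); apply/matrixP => i j; rewrite !mxE.
rewrite -[LHS](coef_map (mmap f h)) rmorphXn /= rmorph_prod /=; congr (_`_ _); congr (polyseq (_ ^+ e)).
by apply: eq_bigr => k _; rewrite map_polyXsubC /= mmapX mmap1U.
Qed.

End Specialization.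

(** * Necessity: from [inA] to [inB] *)

Lemma delta_neq0 r : delta p r != 0.
Proof.
apply/prodf_neq0 => i _; apply/prodf_neq0 => j ij.
by apply: mpolyXU_sub_neq0; rewrite -val_eqE /= ltn_eqF.
Qed.

(* At [X_0 = 0] the first [e] coefficients of [f^e] vanish, hence so does the first row
   of the matrix as soon as [e >= p], while [delta] does not vanish identically. *)
Lemma inA_exponent_lt r e d : inA p r e d -> (e < p)%N.
Proof.
case=> r2 e1 /andP[d1 dp] [eps [g [eps0 g0 E]]].
rewrite ltnNge; apply/negP => pe.
pose h (i : 'I_r) : {poly 'F_p} := if i == 0%N :> nat then 0 else 'X^i.
have : mmap polyC h (\det (Mmat p r e d)) != 0.
  rewrite E mmapZ mulf_neq0 ?polyC_eq0 // rmorphXn expf_neq0 //= mmap_delta.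
  apply/prodf_neq0 => i _; apply/prodf_neq0 => j ij.
  rewrite /h (gtn_eqF (leq_ltn_trans _ ij)) //.
  case: ifP => _; first by rewrite sub0r oppr_eq0 monic_neq0 ?monicXn.
  by rewrite -size_poly_gt0 addrC size_polyDl size_polyN !size_polyXn.
have [s ->] := det_Mmat r e dp.
rewrite rmorphM /= mmap_det_cartier.
case: d d1 dp {E} => // d _ dp; rewrite (expand_det_row _ ord0) big1 ?mulr0 ?eqxx // => j _.
rewrite mxE; case: r r2 @h => // r _ h; rewrite big_ord_recl subr0 exprMn -commr_polyXn coefMXn.
by rewrite ifT ?mul0r // mul1n (leq_trans _ pe) // ltn_subrL ltn0Sn prime_gt0.
Qed.

Definition staircase r (w : nat -> nat) :=
  (forall i j, i < j < r -> w j < w i)%N /\ (forall i j, i <= j -> w j <= w i)%N.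

Lemma size_mmap_delta r w : staircase r w ->
  size (mmap polyC (fun i : 'I_r => 'X^(w i)) (delta p r)) =
  (\sum_(i < r) (r.-1 - i) * w i)%N.+1.
Proof.
move=> [ltw _]; rewrite mmap_delta.
apply: size_prod_succ => i _.
rewrite -sum_gt_ord; apply: size_prod_succ => j ij.
by rewrite size_polyDl ?size_polyN !size_polyXn // ltnS ltw // ij ltn_ord.
Qed.

Lemma inA_weights r e d : inA p r e d ->
  (d * p.-1 <= r * e)%N /\ exists2 g, (0 < g)%N &
  forall w, staircase r w -> (g * \sum_(i < r) (r.-1 - i) * w i =
    \sum_(i < d) top_weight e w (r * e - i.+1 * p.-1))%N.
Proof.
move=> Ha; have ep := inA_exponent_lt Ha.
case: Ha => r2 e1 /andP[d1 dp] [eps [g [eps0 g0 E]]].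
have p1 := prime_gt1 p_prime.
have chF : p \in [pchar 'F_p] by exact: pchar_Fp.
have Ew w : size (mmap polyC (fun i : 'I_r => 'X^(w i)) (\det (Mmat p r e d))) =
            size (mmap polyC (fun i : 'I_r => 'X^(w i)) (delta p r) ^+ g).
  by rewrite E mmapZ size_Cmul // rmorphXn.
have [s Es] := det_Mmat r e dp.
(* Otherwise the last row vanishes: its indices are at least [d * p.-1], beyond the degree of
   [f^e]. *)
have dN : (d * p.-1 <= r * e)%N.
  rewrite leqNgt; apply/negP => Nd.
  have : \det (Mmat p r e d) != 0.
    by rewrite E scaler_eq0 negb_or eps0 expf_neq0 // delta_neq0.
  rewrite Es; case: d d1 dp Nd {E Es Ew} => // d _ dp Nd.
  rewrite (expand_det_row _ ord_max) big1 ?mulr0 ?eqxx // => j _.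
  rewrite mxE nth_default ?mul0r //.
  apply: (leq_trans (size_prod_XsubC_exp_leq _ _)).
  have := ltn_ord j; rewrite -[in (_ * p)%N](prednK (ltnW p1)) mulnS /=; lia.
split=> //; exists g => // w [ltw lew].
apply: succn_inj; rewrite -(size_det_cartier_prod_XsubXn chF) //.
have := Ew w; rewrite Es rmorphM rmorph_sign size_Msign /= mmap_det_cartier => ->.
rewrite -[RHS]prednK ?size_exp; last by rewrite size_poly_gt0 expf_neq0 // -size_poly_gt0 size_mmap_delta.
by rewrite size_mmap_delta // mulnC.
Qed.

Lemma inA_inB r e d : inA p r e d -> inB p r e d.
Proof.
move=> Ha; have ep := inA_exponent_lt Ha; have [dN [g g0 Eg]] := inA_weights Ha.
case: Ha => r2 e1 /andP[d1 dp] _.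
(* A fixed staircase with its first [t] steps raised by 1. Subtracting the identity for [t = 0]
   isolates this direction; [t = 1], [t = 2] and [t = r] give the three equations. *)
pose w t i := (r.-1 - i + (i < t))%N.
have wS t : (t <= r)%N -> staircase r (w t) by move=> tr; split=> i j; rewrite /w; lia.
have tw t m : top_weight e (w t) m = (top_weight e (w 0%N) m + minn m (t * e))%N.
  rewrite /top_weight -sum_lt_minn -big_split; apply: eq_bigr => l _ /=.
  by rewrite /w ltn0 addn0 ltn_divLR.
have bump t : (t <= r)%N -> (g * \sum_(i < r) (r.-1 - i) * (i < t) =
    \sum_(i < d) minn (r * e - i.+1 * p.-1) (t * e))%N.
  move=> tr; have := Eg _ (wS t tr); rewrite (eq_bigr _ (fun i _ => tw t _)) big_split /=.
  rewrite -(Eg _ (wS 0%N isT)) => H; apply/eqP.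
  rewrite -(eqn_add2l (g * \sum_(i < r) (r.-1 - i) * w 0%N i)%N) -H -mulnDr -big_split /=.
  by apply/eqP; congr muln; apply: eq_bigr => i _; rewrite /w ltn0 addn0 -mulnDr.
set N := (r * e)%N in dN bump; set b := (N - d * p.-1)%N.
have bump' t : (t <= r)%N -> (g * \sum_(i < r) (r.-1 - i) * (i < t) =
    \sum_(k < d) minn (b + k * p.-1) (t * e))%N.
  by move=> tr; rewrite bump // (sum_sub_arith (fun a => minn a (t * e)) dN).
have en : (e <= p.-1)%N by lia.
have EN : N = (d * p.-1 + b)%N by rewrite subnKC.
clearbody b; case: d d1 dp {dN Eg bump} bump' EN => // d _ dp bump' EN.
case: r r2 @N bump' EN {w wS tw} => // r r2 N bump' EN.
have E1 : (g * r = minn b e + d * e)%N.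
  have := bump' 1%N isT; rewrite mul1n sum_min_arith ?(leq_trans en) ?leq_addl // => <-.
  by rewrite big_ord_recl big1 ?addn0 ?muln1 ?subn0 // => i _; rewrite muln0.
(* Since [e <= p.-1], the minimum is certainly [2 * e] only from the third term on, so the first two
   stay explicit. *)
have E2 : (g * (2 * r).-1 = minn b (2 * e) +
    (if d is d'.+1 then minn (b + p.-1) (2 * e) + d' * (2 * e) else 0))%N.
  have := bump' 2%N r2; case: r r2 {E1 EN N bump'} => // r _.
  have -> : (2 * r.+1).-1 = (r.+1 + r)%N by lia.
  rewrite !big_ord_recl big1 => [|i _]; last by rewrite /= muln0.
  rewrite /= /bump /= mul0n !muln1 !addn0 subn0 subn1 /= => ->.
  congr addn; case: (d) => [|d']; first by rewrite big_ord0.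
  under eq_bigr => k _ do rewrite add1n mulSn addnA.
  by rewrite sum_min_arith //; lia.
(* Here the cap [r.+1 * e] is [N], at least every argument, so the minima disappear; doubling clears
   the halves in both arithmetic sums. *)
have E3 : (g * (r.+1 * r) = d.+1 * (2 * b + p.-1 * d))%N.
  rewrite -sum_arith -(sum_pred_sub r.+1) mulnCA; congr muln.
  have := bump' r.+1 (leqnn _).
  under eq_bigr => i _ do rewrite ltn_ord muln1.
  move=> ->; apply: eq_bigr => k _; apply/minn_idPl.
  by rewrite -/N EN addnC leq_add2r leq_mul2r ltnW ?orbT ?ltn_ord.
have Es : (e + (p.-1 - e))%N = p.-1 by rewrite subnKC.
have := @weight_equations_solve r e d (p.-1 - e) b g; rewrite Es.
case/(_ r2 e1 g0 EN E1 E2 E3) => [[s0 dr]|[dr lt_s le_s]|[dr lt_s eq_s]].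
- by left; split; [lia | lia | rewrite dr].
- by right; left; split; lia.
- by right; right; split; lia.
Qed.

(** * Sufficiency: from [inB] to [inA] *)

(** The lower bound on [r * e] makes the determinant nonzero, the upper bound makes [delta ^+ g]
    divide it, and the last equation, doubled, matches the degrees, so the quotient is constant. *)
Lemma inA_of_degree r e d : (2 <= r)%N -> (p.-1 < 2 * e)%N -> (e < p)%N ->
  (0 < d <= p)%N -> (d * p.-1 <= r * e <= d.+1 * p.-1)%N ->
  (2 * \sum_(i < d) (r * e - i.+1 * p.-1) = (2 * e - p.-1) * (r * r.-1))%N ->
  inA p r e d.
Proof.
move=> r2 e2 ep dp /andP[dN Nd] deg.
have p1 := prime_gt1 p_prime.
set C := \det (cartier_mx p d (fpoly p r ^+ e)); set g := (2 * e - p).+1.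
have C0 : C != 0.
  have wS : staircase r (fun i => r.-1 - i)%N by split=> i j; lia.
  have := size_det_cartier_prod_XsubXn (pchar_Fp p_prime) _ ep wS.1 wS.2 (proj2 (andP dp)) dN.
  rewrite -(mmap_det_cartier polyC) => /(_ ltac:(lia)) sC.
  by apply/negP => /eqP C00; move: sC; rewrite -/C C00 mmap0 size_poly0.
have dvdC (i j : 'I_r) : (i < j)%N -> exists c, C = ('X_i - 'X_j) ^+ g * c.
  move=> ij; have ji : j != i by rewrite -val_eqE /= gtn_eqF.
  have chR : p \in [pchar {mpoly 'F_p[r]}].
    by rewrite (rmorph_pchar (@mpolyC r 'F_p)) // pchar_Fp.
  rewrite /C /fpoly (bigD1 i) //= (bigD1 j) //= !exprMn mulrA.
  apply: det_cartier_dvd => //; [lia|exact: ltnW|].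
  set h := \prod_(k < r | _) _.
  have sh : (size h).+1 = r.
    rewrite (@size_prod_succ _ _ _ _ _ (fun=> 1%N)) => [|k _]; last exact: size_XsubC.
    by have := card_ord r; rewrite -sum1_card (bigD1 i) //= (bigD1 j).
  have := size_poly_exp_leq h e; move: (size h) sh => m sm le_h.
  apply: (leq_trans (leq_add le_h (leqnn _))); rewrite addSn ltnS -mulnDl.
  by apply: leq_trans Nd; rewrite leq_mul2r; apply/orP; right; lia.
pose s := [seq k : 'I_r * 'I_r <- index_enum _ | (k.1 < k.2)%N].
pose D (k : 'I_r * 'I_r) : {mpoly 'F_p[r]} := 'X_k.1 - 'X_k.2.
have Edelta : delta p r = \prod_(k <- s) D k.
  by rewrite /delta pair_big_dep /= big_filter.
have [Q EQ] : exists Q, C = (\prod_(k <- s) D k ^+ g) * Q.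
  apply: prod_exp_dvd.
  - by rewrite filter_uniq ?index_enum_uniq.
  - move=> k; rewrite mem_filter => /andP[k12 _].
    by apply: mpolyXU_sub_neq0; rewrite -val_eqE /= ltn_eqF.
  - move=> k l; rewrite !mem_filter => /andP[k12 _] /andP[l12 _] kl B.
    exact: mpolyXU_sub_coprime.
  - by move=> k; rewrite mem_filter => /andP[k12 _]; apply: dvdC.
have {}EQ : C = delta p r ^+ g * Q by rewrite EQ Edelta -prodrXl.
have Q0 : Q != 0 by apply: contraNneq C0 => Q0; rewrite EQ Q0 mulr0.
have sdelta : (g * \sum_(i < r) (r.-1 - i) < msize (delta p r ^+ g))%N.
  rewrite -[g in X in (X < _)%N]card_ord -sum_nat_const -[in X in (_ < X)%N](card_ord g) -prodr_const.
  apply: leq_msize_prod => _ _; apply: leq_msize_prod => i _.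
  rewrite -[(r.-1 - i)%N]muln1 -sum_gt_ord; apply: leq_msize_prod => j ij.
  by apply: msize_mpolyXU_sub; rewrite -val_eqE /= ltn_eqF.
have sC : (msize C <= (\sum_(i < d) (r * e - i.+1 * p.-1)).+1)%N.
  apply: msize_det_cartier_leq => //; [exact: ltnW | by case/andP: dp |].
  exact: weighted_degree_le_fpoly_exp.
have degE : (\sum_(i < d) (r * e - i.+1 * p.-1) = g * \sum_(i < r) (r.-1 - i))%N.
  apply/eqP; rewrite -(eqn_pmul2l (isT : 0 < 2)%N) deg [X in _ == X]mulnCA sum_pred_sub; apply/eqP.
  by congr muln; lia.
have sQ : (msize Q <= 1)%N.
  move: sC sdelta; rewrite degE EQ msizeM ?expf_neq0 ?delta_neq0 //.
  by move: (msize _) (msize Q) (g * _)%N => a c m; lia.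
have [b Eb] := det_Mmat r e (proj2 (andP dp)).
split=> //; first lia.
have EQc := msize1_polyC sQ.
exists ((-1) ^+ b * Q@_0), g; split=> //.
  by rewrite mulf_neq0 ?signr_eq0 //; apply: contraNneq Q0 => Qc; rewrite EQc Qc.
by rewrite Eb -/C EQ [in LHS]EQc -scalerA scaler_sign mulr_sign mulrC mul_mpolyC.
Qed.

Lemma inB_inA r e d : inB p r e d -> inA p r e d.
Proof.
have p1 := prime_gt1 p_prime.
(* Here [c] is [d.-1] and [b] is the excess of [r * e] over [d * p.-1]: it is 0 on [inBplus],
   [p.-1 - r * (p.-1 - e)] on [inB0] and [p.-1] on [inBminus]. *)
have inAI b c : (2 <= r)%N -> (p.-1 < 2 * e)%N -> (e <= p.-1)%N -> (c < p)%N ->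
    (r * e = c.+1 * p.-1 + b)%N -> (b <= p.-1)%N ->
    (c.+1 * (2 * b + p.-1 * c) = (2 * e - p.-1) * (r * r.-1))%N -> inA p r e c.+1.
  move=> r2 e2 en cp EN bn deg; have ep : (e < p)%N by lia.
  apply: inA_of_degree => //.
    by rewrite EN leq_addr [(c.+2 * _)%N]mulSn addnC leq_add2r.
  rewrite (sum_sub_arith id); last by rewrite EN leq_addr.
  by rewrite EN addKn sum_arith.
case=> [[/andP[r2 rp] eE ->]|[[/andP[r2 rp] e2 en rs ->]|[r2 e2 en rs ->]]].
- case: r r2 rp inAI => // r r2 rp inAI.
  by apply: (inAI 0%N) => //=; rewrite eE; lia.
- case: r r2 rp rs inAI => [|[|r]] // r2 rp rs inAI /=.
  have [g Eg] : exists g, (2 * e = p.-1 + g)%N by exists (2 * e - p.-1)%N; lia.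
  have EN : (r.+2 * e + r.+2 * (p.-1 - e) = r.+2 * p.-1)%N by rewrite -mulnDr subnKC.
  have Eg' : (r.+2 * (2 * e) = r.+2 * (p.-1 + g))%N by rewrite Eg.
  have Eb : (r.+2 * e = r.+1 * p.-1 + (p.-1 - r.+2 * (p.-1 - e)))%N by lia.
  apply: (inAI _ _ r2 e2 en _ Eb); [lia | lia |].
  rewrite Eg addKn mulnA [(g * _)%N]mulnC mulnC; congr muln.
  by move: Eb Eg'; move: (p.-1 - r.+2 * _)%N => b; lia.
(* For [r = 2], where [d] would be 0, [rs] contradicts [p.-1 < 2 * e]. *)
- case: r r2 rs inAI => [|[|[|r]]] // r2 rs inAI /=; first by move: rs; lia.
  have [g Eg] : exists g, (2 * e = p.-1 + g)%N by exists (2 * e - p.-1)%N; lia.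
  have EN : (r.+3 * e + r.+3 * (p.-1 - e) = r.+3 * p.-1)%N by rewrite -mulnDr subnKC.
  have Eb : (r.+3 * e = r.+1 * p.-1 + p.-1)%N by lia.
  have Eg' : (r.+3 * (2 * e) = r.+3 * (p.-1 + g))%N by rewrite Eg.
  have rp : (r < p)%N.
    have s0 : (0 < p.-1 - e)%N by rewrite lt0n; apply/eqP => s0; move: rs; rewrite s0; lia.
    by have := leq_pmulr r.+3 s0; lia.
  apply: (inAI _ _ r2 e2 en rp Eb) => //.
  have Eg3 : (g * r.+3 = r.+1 * p.-1)%N by lia.
  by rewrite Eg addKn mulnA Eg3; lia.
Qed.

End PrimeField.
End Development.

Theorem theorem4 (p q : nat) :
  prime q -> p = (2 * q).+1 -> prime p ->
  forall r e d : nat, inA p r e d <-> inB p r e d.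
Proof.
move=> _ _ p_prime r e d.
by split; [apply: inA_inB | apply: inB_inA].
Qed.
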